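(* Let $A\in\mathbb{C}^{m\times n}$, $W\in\mathbb{C}^{n\times m}$ with $k=\max\{\mathrm{ind}(AW),\mathrm{ind}(WA)\}$. Then the $W$-weighted core-EP inverse $A^{\mathrm{cEP},W}$ of $A$ is the $((AW)^k,[(WA)^k]^* )$-inverse of $WAW$.
   Context: For a square complex matrix $B$, $\mathrm{ind}(B)$ is the smallest non-negative integer $j$ with $\mathrm{rank}(B^j)=\mathrm{rank}(B^{j+1})$ (with $B^0=I$). $B^*$, $B^{\dagger}$ and $\mathcal{R}(B)$ denote the conjugate transpose, Moore-Penrose inverse and range (column space) of $B$. For $A\in\mathbb{C}^{m\times n}$, $W\in\mathbb{C}^{n\times m}$ and $k=\max\{\mathrm{ind}(AW),\mathrm{ind}(WA)\}$, the $W$-weighted core-EP inverse $A^{\mathrm{cEP},W}$ is the unique $Y\in\mathbb{C}^{m\times n}$ with $WAWY=(WA)^k[(WA)^k]^{\dagger}$ and $\mathcal{R}(Y)\subseteq\mathcal{R}((AW)^k)$. For $M\in\mathbb{C}^{n\times m}$, $B\in\mathbb{C}^{m\times m}$, $C\in\mathbb{C}^{n\times n}$ and $X\in\mathbb{C}^{m\times n}$, $X$ is the $(B,C)$-inverse of $M$ if $X\in B\mathbb{C}^{m\times m}X\cap X\mathbb{C}^{n\times n}C$, $XMB=B$ and $CMX=C$. *)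

(* Defs.v *)
From mathcomp Require Import all_boot all_order all_algebra.
From mathcomp Require Import all_reals complex.

Set Implicit Arguments.
Unset Strict Implicit.
Unset Printing Implicit Defensive.

Import Order.TTheory GRing.Theory Num.Theory.
Local Open Scope ring_scope.
Local Open Scope sesquilinear_scope.

Section Index.
Variables (C : numClosedFieldType) (n : nat).
Implicit Types B : 'M[C]_n.

Lemma mxindex_exists B : exists j, \rank (B ^+ j) == \rank (B ^+ j.+1).
Proof.
have [/existsP[j Bj]|] := boolP [exists j : 'I_n.+1,
    \rank (B ^+ j) == \rank (B ^+ j.+1)]; first by exists j.
rewrite negb_exists => /forallP Bn.
suff H j : (j <= n.+1)%N -> (\rank (B ^+ j) + j <= n)%N.
  by have := leq_trans (leq_addl _ _) (H _ (leqnn _)); rewrite ltnn.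
elim: j => [|j IHj] jn; first by rewrite addn0 rank_leq_row.
rewrite addnS -addSn; apply: leq_trans (IHj (ltnW jn)); rewrite leq_add2r.
by rewrite ltn_neqAle eq_sym (Bn (Ordinal jn)) exprS mxrankM_maxr.
Qed.

Definition mxindex B : nat := ex_minn (mxindex_exists B).

Lemma mxindex_rank B : \rank (B ^+ mxindex B) = \rank (B ^+ (mxindex B).+1).
Proof. by rewrite /mxindex; case: ex_minnP => j /eqP. Qed.

Lemma mxindex_min B j : \rank (B ^+ j) = \rank (B ^+ j.+1) -> (mxindex B <= j)%N.
Proof.
by move=> /eqP Bj; rewrite /mxindex; case: ex_minnP => i _; apply.
Qed.

Lemma mxindex_kl B k : (mxindex B <= k)%N -> exists Z, B ^+ k = Z *m B ^+ k.+1.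
Proof.
move=> /subnKC <-; set i := mxindex B.
have /submxP[Z defB] : (B ^+ i <= B ^+ i.+1)%MS.
  have /mxrank_leqif_sup/geq_leqif : (B ^+ i.+1 <= B ^+ i)%MS.
    by rewrite exprS submxMl.
  by rewrite mxindex_rank leqnn.
exists Z; rewrite -addSn ![_ ^+ (_ + (_ - _))]exprD {1}defB.
by rewrite !mulmxE mulrA.
Qed.

Lemma mxindex_kr B k : (mxindex B <= k)%N -> exists Z, B ^+ k = B ^+ k.+1 *m Z.
Proof.
move=> /subnK <-; set i := mxindex B.
have /submxP[Z defB] : ((B ^+ i)^T <= (B ^+ i.+1)^T)%MS.
  have /mxrank_leqif_sup/geq_leqif : ((B ^+ i.+1)^T <= (B ^+ i)^T)%MS.
    by rewrite exprSr trmx_mul submxMl.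
  by rewrite !mxrank_tr mxindex_rank leqnn.
exists Z^T; rewrite -addnS ![_ ^+ (_ - _ + _)]exprD -mulmxE -mulmxA.
by congr (_ *m _); rewrite -[LHS]trmxK defB trmx_mul trmxK.
Qed.

End Index.

Section MoorePenrose.
Variable C : numClosedFieldType.

(* The four Penrose equations. *)
Definition is_mpinv m n (A : 'M[C]_(m, n)) (X : 'M[C]_(n, m)) : bool :=
  [&& A *m X *m A == A, X *m A *m X == X,
      (A *m X)^t* == A *m X & (X *m A)^t* == X *m A].

Lemma trmxC_mul m n p (A : 'M[C]_(m, n)) (B : 'M_(n, p)) :
  (A *m B)^t* = B^t* *m A^t*.
Proof. by rewrite trmx_mul map_mxM. Qed.

Lemma mulmx_trmxC_unit m n (A : 'M[C]_(m, n)) :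
  row_free A -> A *m A^t* \in unitmx.
Proof.
move=> Afree; rewrite -row_free_unit -kermx_eq0.
apply/eqP/row_matrixP => i; rewrite row0; set u := row i _.
have uA0 : u *m (A *m A^t*) = 0 by apply/sub_kermxP; rewrite row_sub.
have /eqP : dotmx (u *m A) (u *m A) = 0.
  by rewrite dotmxE trmxC_mul mulmxA -(mulmxA u) uA0 mul0mx mxE.
by rewrite dnorm_eq0 mulmx_free_eq0 // => /eqP.
Qed.

Lemma mpinv_exists m n (A : 'M[C]_(m, n)) : exists X, is_mpinv A X.
Proof.
have [r [F [G [fF fG ->]]]] : exists r (F : 'M[C]_(m, r)) (G : 'M_(r, n)),
    [/\ row_full F, row_free G & A = F *m G].
  exists (\rank A), (col_base A), (row_base A).
  by rewrite row_base_free mulmx_base; split=> //; apply: col_base_full.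
have uG : G *m G^t* \in unitmx by exact: mulmx_trmxC_unit.
have uF : F^t* *m F \in unitmx.
  rewrite -{2}[F]trmxCK mulmx_trmxC_unit //.
  by rewrite /row_free mxrank_map mxrank_tr.
pose Gi := G^t* *m invmx (G *m G^t*); pose Fi := invmx (F^t* *m F) *m F^t*.
have GGi : G *m Gi = 1%:M by rewrite mulmxA mulmxV.
have FiF : Fi *m F = 1%:M by rewrite -mulmxA mulVmx.
have trI p (M : 'M[C]_p) : M^t* = M -> (invmx M)^t* = invmx M.
  by move=> MM; rewrite trmx_inv map_invmx MM.
have AX : F *m G *m (Gi *m Fi) = F *m Fi.
  by rewrite -mulmxA (mulmxA G) GGi mul1mx.
have XA : (Gi *m Fi) *m (F *m G) = Gi *m G.
  by rewrite -mulmxA (mulmxA Fi) FiF mul1mx.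
exists (Gi *m Fi); apply/and4P; split; apply/eqP.
- by rewrite AX -(mulmxA F) (mulmxA Fi) FiF mul1mx.
- by rewrite XA -(mulmxA Gi) (mulmxA G) GGi mul1mx.
- rewrite AX /Fi !trmxC_mul trmxCK trI ?mulmxA //.
  by rewrite trmxC_mul trmxCK.
- rewrite XA /Gi !trmxC_mul trmxCK trI ?mulmxA //.
  by rewrite trmxC_mul trmxCK.
Qed.

Definition mpinv m n (A : 'M[C]_(m, n)) : 'M[C]_(n, m) :=
  xchoose (mpinv_exists A).

Lemma mpinvP m n (A : 'M[C]_(m, n)) : is_mpinv A (mpinv A).
Proof. exact: xchooseP. Qed.

Lemma mpinv_uniq m n (A : 'M[C]_(m, n)) X : is_mpinv A X -> X = mpinv A.
Proof.
have /and4P[/eqP AYA /eqP YAY /eqP hAY /eqP hYA] := mpinvP A.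
move: (mpinv A) AYA YAY hAY hYA => Y AYA YAY hAY hYA.
move=> /and4P[/eqP AXA /eqP XAX /eqP hAX /eqP hXA].
have eAX : A *m X = A *m Y.
  by rewrite -hAX -[in LHS]AYA -mulmxA trmxC_mul hAX hAY mulmxA AXA.
have eXA : X *m A = Y *m A.
  by rewrite -hXA -[in LHS]AYA -(mulmxA A) mulmxA trmxC_mul hXA hYA
    -mulmxA (mulmxA A) AXA.
by rewrite -XAX -mulmxA eAX mulmxA eXA YAY.
Qed.

End MoorePenrose.

Section WeightedCoreEP.
Variables (C : numClosedFieldType) (m n : nat).
Implicit Types (A Y : 'M[C]_(m, n)) (W : 'M[C]_(n, m)).

(* mxalgebra compares row spaces, so column spaces are compared through the
   transposes. *)
Definition range_sub p q r (Y : 'M[C]_(p, q)) (B : 'M[C]_(p, r)) : bool :=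
  (Y^T <= B^T)%MS.

Lemma range_subP p q r (Y : 'M[C]_(p, q)) (B : 'M[C]_(p, r)) :
  reflect (forall x : 'cV_q, exists z : 'cV_r, Y *m x = B *m z) (range_sub Y B).
Proof.
apply: (iffP submxP) => [[D defY] x|YB].
  exists (D^T *m x); rewrite mulmxA; congr (_ *m _).
  by rewrite -[Y]trmxK defY trmx_mul trmxK.
apply/submxP/row_subP => i; have [z Yz] := YB (delta_mx i 0).
rewrite -tr_col colE Yz trmx_mul; exact: submxMl.
Qed.

Definition windex A W : nat := maxn (mxindex (A *m W)) (mxindex (W *m A)).

Definition is_wcep A W Y : bool :=
  let k := windex A W in
  (W *m A *m W *m Y == (W *m A) ^+ k *m mpinv ((W *m A) ^+ k))
  && range_sub Y ((A *m W) ^+ k).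

Lemma mulmx_expC A W k : A *m (W *m A) ^+ k = (A *m W) ^+ k *m A.
Proof.
elim: k => [|k IHk]; first by rewrite !expr0 mulmx1 mul1mx.
by rewrite !exprS -!mulmxE -!mulmxA IHk.
Qed.

Lemma wcep_exists A W : exists Y, is_wcep A W Y.
Proof.
pose k := windex A W; pose P := mpinv ((W *m A) ^+ k).
have hk : (mxindex (W *m A) <= k)%N by rewrite leq_maxr.
have [Z1 e1] := mxindex_kr hk.
have [Z2 e2] := mxindex_kr (leqW hk).
exists ((A *m W) ^+ k *m (A *m (Z2 *m Z1 *m P))); apply/andP; split.
  rewrite -/k -/P (mulmxA _ A) -mulmx_expC !mulmxA.
  rewrite -(mulmxA (W *m A *m W)) -(mulmxA (W *m A)) (mulmxA W A).
  by rewrite !mulmxE -!exprS -!mulmxE -e2 -e1.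
by rewrite /range_sub trmx_mul submxMl.
Qed.

Lemma wcep_uniq A W Y1 Y2 : is_wcep A W Y1 -> is_wcep A W Y2 -> Y1 = Y2.
Proof.
rewrite /is_wcep; set k := windex A W.
move=> /andP[/eqP e1 /submxP[D1 d1]] /andP[/eqP e2 /submxP[D2 d2]].
have hk : (mxindex (A *m W) <= k)%N by rewrite leq_maxl.
have [Z1 z1] := mxindex_kl hk; have [Z2 z2] := mxindex_kl (leqW hk).
have defY Y D : Y^T = D *m ((A *m W) ^+ k)^T -> Y = (A *m W) ^+ k *m D^T.
  by move=> YD; rewrite -[Y]trmxK YD trmx_mul trmxK.
rewrite (defY _ _ d1) (defY _ _ d2) z1 z2 !exprS -!mulmxE -!mulmxA.
rewrite -(defY _ _ d1) -(defY _ _ d2).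
by do 3 congr (_ *m _); rewrite !mulmxA e1 e2.
Qed.

Definition wcep A W : 'M[C]_(m, n) := xchoose (wcep_exists A W).

Lemma wcepP A W : is_wcep A W (wcep A W).
Proof. exact: xchooseP. Qed.

End WeightedCoreEP.

Section BCInverse.
Variables (C : numClosedFieldType) (m n : nat).

(* The first two clauses unfold X \in B C^{m x m} X \cap X C^{n x n} D, where D
   plays the part of the second matrix of a (B, C)-inverse. *)
Definition is_bc_inverse (B : 'M[C]_m) (D : 'M[C]_n) (M : 'M[C]_(n, m))
    (X : 'M[C]_(m, n)) : Prop :=
  [/\ exists S : 'M[C]_m, X = B *m S *m X,
      exists T : 'M[C]_n, X = X *m T *m D,
      X *m M *m B = B
    & D *m M *m X = D].

Lemma bc_inverse_uniq B D M X Y :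
  is_bc_inverse B D M X -> is_bc_inverse B D M Y -> X = Y.
Proof.
move=> [_ [T defX] XMB _] [[S defY] _ _ DMY].
have <- : X *m M *m Y = X by rewrite {1}defX -!mulmxA (mulmxA D) DMY mulmxA.
by rewrite defY !mulmxA XMB.
Qed.

End BCInverse.

(* Main.v *)
Require Import Defs.
From mathcomp Require Import all_boot all_order all_algebra.
From mathcomp Require Import all_reals complex.
Import Order.TTheory GRing.Theory Num.Theory.
Local Open Scope ring_scope.
Local Open Scope complex_scope.
Local Open Scope sesquilinear_scope.

(** Write M = W A W, E = (AW)^k, F = (WA)^k, P = F F^dagger and Y for the
    weighted core-EP inverse, so that M Y = P and Y = E D for some D.

    Since A M = (AW)^2 and the ranks of the powers of AW are stationary from k
    on, M is injective on the column space of E, in the strong form of a matrix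
    L with L M E = E ([wcep_left_inverse]).  As Y factors through E, also
    L M Y = Y.  An equation between matrices with columns in the range of E can
    therefore be checked after multiplying by M on the left, where M Y becomes
    the orthogonal projector P onto the range of F.  The columns of M E = F M
    lie in that range, so P M E = M E, which gives Y M E = E ([wcep_mulK]), and
    Y M Y = Y follows because Y = E D ([wcep_outer]).

    The membership clauses follow by factoring the two idempotents in
    Y = (Y M) Y = Y (M Y): Y M = E (D M), and M Y = P = P^* = (F^dagger)^* F^*.
    The last equation F^* M Y = F^* is the adjoint of P F = F. *)

Lemma mpinv_range (C : numClosedFieldType) m n (F : 'M[C]_(m, n)) :
  F *m mpinv F *m F = F.
Proof. by have /and4P[/eqP] := mpinvP F. Qed.

Lemma mpinv_projC (C : numClosedFieldType) m n (F : 'M[C]_(m, n)) :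
  (F *m mpinv F)^t* = F *m mpinv F.
Proof. by have /and4P[_ _ /eqP] := mpinvP F. Qed.

Section WeightedCoreEPInverse.
Context {C : numClosedFieldType} {m n : nat}.
Variables (A : 'M[C]_(m, n)) (W : 'M[C]_(n, m)).

Let k := windex A W.
Let E := (A *m W) ^+ k.
Let F := (W *m A) ^+ k.
Let P := F *m mpinv F.
Let M := W *m A *m W.
Let Y := wcep A W.

Lemma wcep_proj : M *m Y = P.
Proof. by have /andP[/eqP] := wcepP A W. Qed.

Lemma wcep_factor : exists D, Y = E *m D.
Proof.
have /andP[_ /submxP[D defY]] := wcepP A W.
by exists D^T; rewrite -[LHS]trmxK defY trmx_mul trmxK.
Qed.

(** The index condition allows two extra factors AW to be cancelled on the
    left of E, and A M = (AW)^2 supplies exactly two. *)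
Lemma wcep_left_inverse : exists L, L *m M *m E = E.
Proof.
have hk : (mxindex (A *m W) <= k)%N by rewrite leq_maxl.
have [Z1 e1] := mxindex_kl hk; have [Z2 e2] := mxindex_kl (leqW hk).
exists (Z1 *m Z2 *m A).
rewrite [RHS](e1 : E = _) e2 !exprS -!mulmxE.
by rewrite /E /M !mulmxA.
Qed.

Lemma wcep_range_proj : P *m (M *m E) = M *m E.
Proof.
have -> : M *m E = F *m M.
  rewrite /M /E /F -(mulmxA (W *m A)) (mulmx_expC W A) !mulmxA.
  by rewrite !mulmxE -exprS exprSr -!mulmxE !mulmxA.
by rewrite mulmxA mpinv_range.
Qed.

Lemma wcep_mulK : Y *m M *m E = E.
Proof.
have [D defY] := wcep_factor; have [L LME] := wcep_left_inverse.
have LMY : L *m (M *m Y) = Y.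
  by rewrite defY (mulmxA L) (mulmxA (L *m M)) LME.
rewrite -{1}LMY wcep_proj -(mulmxA (L *m P)) -(mulmxA L) wcep_range_proj.
by rewrite mulmxA LME.
Qed.

(** Right multiplication by D turns Y M E = E into this identity. *)
Lemma wcep_outer : Y *m M *m Y = Y.
Proof.
have [D defY] := wcep_factor.
by rewrite {2}defY mulmxA wcep_mulK -defY.
Qed.

Lemma wcep_bc_inverse : is_bc_inverse E (F^t*) M Y.
Proof.
split.
- have [D defY] := wcep_factor.
  by exists (D *m M); rewrite mulmxA -defY wcep_outer.
- exists ((mpinv F)^t*).
  by rewrite -mulmxA -trmxC_mul mpinv_projC -/P -wcep_proj mulmxA wcep_outer.
- exact: wcep_mulK.
- by rewrite -mulmxA wcep_proj /P -mpinv_projC -trmxC_mul mpinv_range.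
Qed.

End WeightedCoreEPInverse.

Theorem theorem4p5 (R : realType) (m n : nat)
    (A : 'M[R[i]]_(m, n)) (W : 'M[R[i]]_(n, m)) (k : nat)
    (hk : k = maxn (mxindex (A *m W)) (mxindex (W *m A))) :
  is_bc_inverse ((A *m W) ^+ k) (((W *m A) ^+ k)^t*) (W *m A *m W) (wcep A W).
Proof. by rewrite hk; apply: wcep_bc_inverse. Qed.
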